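(* Let $F$ be a field of characteristic $0$, let $n>2$ be an integer, and let $\mathcal{A}=M_n(F)$. If a polynomial $f\in F\langle\mathcal{X}\rangle$ is $2$-central for $\mathcal{A}$, then the set of all linear combinations of two matrices from $f(\mathcal{A})$, i.e. $\{\alpha A+\beta B\mid \alpha,\beta\in F,\ A,B\in f(\mathcal{A})\}$, does not contain all trace zero matrices of $\mathcal{A}$. In particular, not every trace zero matrix in $\mathcal{A}$ lies in $f(\mathcal{A})-f(\mathcal{A})$.
   Context: $F\langle\mathcal{X}\rangle$ is the free unital associative algebra over $F$ generated by $\mathcal{X}=\{X_1,X_2,\dots\}$; its elements are called (noncommutative) polynomials. For $f=f(X_1,\dots,X_m)$ and an $F$-algebra $\mathcal{A}$, the image of $f$ is $f(\mathcal{A})=\{f(a_1,\dots,a_m)\mid a_1,\dots,a_m\in\mathcal{A}\}$. The polynomial $f$ is an identity of $\mathcal{A}$ if $f(\mathcal{A})=\{0\}$; it is a central polynomial for $\mathcal{A}$ (is central for $\mathcal{A}$) if $f(\mathcal{A})$ is contained in the center of $\mathcal{A}$ but $f$ is not an identity of $\mathcal{A}$. The polynomial $f$ is $2$-central for $\mathcal{A}$ if $f^2$ is central for $\mathcal{A}$ but $f$ is not. Moreover, $f(\mathcal{A})-f(\mathcal{A})=\{s-t\mid s,t\in f(\mathcal{A})\}$. *)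

(* Defs.v *)
From mathcomp Require Import all_boot all_order all_algebra.
From mathcomp.multinomials Require Import monalg.

Set Implicit Arguments.
Unset Strict Implicit.
Unset Printing Implicit Defensive.

Import GRing.Theory.
Local Open Scope ring_scope.

(* The free unital associative algebra F<X_1, X_2, ...>, as the monoid algebra
   of the free monoid (words) on nat.  The generators are numbered from 0. *)
Notation ncpoly F := {malg F[{fmonom nat}]}.

Section Image.
Context (F : fieldType) (A : algType F).
Implicit Types (f : ncpoly F) (x : A).

Definition word_eval (a : nat -> A) (w : {fmonom nat}) : A :=
  \prod_(i <- w) a i.

Definition nceval (a : nat -> A) f : A := mmap (in_alg A) (word_eval a) f.

(* [a] assigns a value to every generator; only the values at the finitely many
   generators occurring in [f] matter, so this is f(A). *)
Definition ncimage f x : Prop := exists a : nat -> A, x = nceval a f.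

Definition in_center x : Prop := forall y : A, GRing.comm x y.

Definition is_identity f : Prop := forall x, ncimage f x <-> x = 0.

Definition is_central f : Prop :=
  (forall x, ncimage f x -> in_center x) /\ ~ is_identity f.

Definition is_2central f : Prop := is_central (f ^+ 2) /\ ~ is_central f.

End Image.

Arguments word_eval {F} A a w.
Arguments nceval {F} A a f.
Arguments ncimage {F} A f x.
Arguments is_identity {F} A f.
Arguments is_central {F} A f.
Arguments is_2central {F} A f.

(* Main.v *)
(* If A and B have central squares and C = A + B, then C^2 = A^2 + B^2 + (AB + BA)
   commutes with A and with B.  When C = diag(c_i) with pairwise distinct c_i^2,
   this forces A and B to be diagonal, say A = diag(x_i) and B = diag(y_i), where
   x_i^2 = a and y_i^2 = b do not depend on i.  Then (x_i y_i)^2 = ab, so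
   c_i^2 = a + b + 2 x_i y_i takes at most two values, which is impossible for
   matrices of size at least 3.  A trace zero diagonal matrix with distinct squares
   is diag(1, 2, ..., n, -(1 + ... + n)), for n > 1. *)
From HB Require Import structures.
Require Import Defs.
From mathcomp Require Import all_boot all_order all_algebra.
From mathcomp.multinomials Require Import monalg.
From mathcomp Require Import zify.
Import GRing.Theory.
Local Open Scope ring_scope.

Lemma word_eval_is_mmorphism (F : fieldType) (A : algType F) (a : nat -> A) :
  mmorphism (word_eval A a).
Proof.
by split=> [u v|]; rewrite /word_eval ?fmM ?big_cat ?fm1 ?big_nil.
Qed.

HB.instance Definition _ (F : fieldType) (A : algType F) (a : nat -> A) :=
  monalg.isMultiplicative.Build {fmonom nat} A (word_eval A a)
    (word_eval_is_mmorphism F A a).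

(** Evaluation is multiplicative because the coefficients act as scalars, which commute with the
    value of every word. *)
Lemma nceval_sqr (F : fieldType) (A : algType F) (a : nat -> A) (f : ncpoly F) :
  nceval A a (f ^+ 2) = nceval A a f ^+ 2.
Proof.
have comm_f (g : ncpoly F) (u v : {fmonom nat}) :
    GRing.comm (in_alg A g@_u) (word_eval A a v).
  by rewrite /GRing.comm /= mulr_algl mulr_algr.
by rewrite !expr2 /nceval (commr_mmap_is_multiplicative comm_f).1.
Qed.

Lemma ncimage_sqr_center (F : fieldType) (A : algType F) (f : ncpoly F) (x : A) :
  is_2central A f -> ncimage A f x -> in_center (x ^+ 2).
Proof.
by move=> [[cen_f _] _] [a ->]; apply: cen_f; exists a; rewrite nceval_sqr.
Qed.

(** Absorbs the coefficients of a linear combination into the two matrices, so that only plain sums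
    [A + B] need be treated. *)
Lemma in_center_sqrZ (F : fieldType) (A : algType F) (k : F) (x : A) :
  in_center (x ^+ 2) -> in_center ((k *: x) ^+ 2).
Proof.
by move=> cen_x y; rewrite exprZn /GRing.comm -scalerAl -scalerAr cen_x.
Qed.

Lemma comm_sqr_add (R : pzRingType) (x y : R) :
  (forall z, GRing.comm (x ^+ 2) z) -> (forall z, GRing.comm (y ^+ 2) z) ->
  GRing.comm x ((x + y) ^+ 2).
Proof.
move=> cen_x cen_y; rewrite expr2 mulrDl !mulrDr -!expr2.
(* Both products equal [x * y * x] plus [x ^+ 2 * y], since [x ^+ 2] is central. *)
have cxy : GRing.comm x (x * y + y * x).
  by rewrite /GRing.comm mulrDr mulrDl !mulrA -expr2 cen_x -(mulrA y) -expr2 -cen_x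
             cen_x addrC.
by rewrite -addrA (addrA (x * y)); do 2?apply: commrD => //; apply: commr_sym.
Qed.

(** Compare the [(i, j)] entries of the two products of [Z] with the matrix unit at [(i, j)]. *)
Lemma in_center_diag_const (F : fieldType) n (Z : 'M[F]_n.+1) (i j : 'I_n.+1) :
  in_center Z -> Z i i = Z j j.
Proof.
move=> /(_ (delta_mx i j)) /matrixP /(_ i j).
rewrite !mxE (bigD1 i) //= [RHS](bigD1 j) //= !mxE !eqxx mulr1 mul1r.
rewrite !big1 ?addr0 // => k /negPf nk; last by rewrite !mxE nk mulr0.
by rewrite !mxE nk andbF mul0r.
Qed.

Lemma comm_diag_mx_offdiag (F : fieldType) n (d : 'rV[F]_n) (A : 'M[F]_n) (i j : 'I_n) :
  d 0 i != d 0 j -> A *m diag_mx d = diag_mx d *m A -> A i j = 0.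
Proof.
move=> dij /matrixP /(_ i j); rewrite mul_mx_diag mul_diag_mx !mxE => /eqP.
rewrite mulrC -subr_eq0 -mulrBl mulf_eq0 subr_eq0 eq_sym (negPf dij).
by move=> /eqP.
Qed.

Lemma diag_mx_sqr_neq_add (F : fieldType) n (c : 'rV[F]_n.+1) (A B : 'M[F]_n.+1) :
  (1 < n)%N -> injective (fun i => c 0 i ^+ 2) ->
  in_center (A ^+ 2) -> in_center (B ^+ 2) -> diag_mx c <> A + B.
Proof.
move=> n_gt1 c2_inj cenA cenB defC.
have c2E : (A + B) ^+ 2 = diag_mx (\row_i (c 0 i ^+ 2)).
  by rewrite -defC expr2 [LHS]mulmx_diag; congr diag_mx.
(* Stated for a generic pair so that it applies to [A] and, after swapping the summands, to [B]. *)
have offdiag (X Y : 'M[F]_n.+1) : in_center (X ^+ 2) -> in_center (Y ^+ 2) ->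
    X + Y = A + B -> forall i j, i != j -> X i j = 0.
  move=> cenX cenY defXY i j nij.
  apply: (comm_diag_mx_offdiag F _ (\row_i (c 0 i ^+ 2))).
    by rewrite !mxE (inj_eq c2_inj).
  by rewrite -c2E -defXY; apply: comm_sqr_add.
have offA := offdiag A B cenA cenB erefl.
have offB := offdiag B A cenB cenA (addrC B A).
have sqr_diag (X : 'M[F]_n.+1) : in_center (X ^+ 2) ->
    (forall i j, i != j -> X i j = 0) -> forall i j, X i i ^+ 2 = X j j ^+ 2.
  move=> cenX offX i j.
  have sqrE k : X k k ^+ 2 = (X ^+ 2) k k.
    rewrite expr2 mxE (bigD1 k) //= big1 ?addr0 ?expr2 // => l nlk.
    by rewrite offX ?mul0r 1?eq_sym.
  by rewrite !sqrE; apply: in_center_diag_const.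
have cE i : c 0 i = A i i + B i i.
  by have /matrixP/(_ i i) := defC; rewrite !mxE eqxx mulr1n.
pose e i := A i i * B i i.
(* The squares of [A i i] and [B i i] do not depend on [i], so [e i] determines [c 0 i ^+ 2]. *)
have e_inj i j : e i = e j -> i = j.
  move=> eij; apply: c2_inj; rewrite /= !cE !sqrrD.
  by rewrite (sqr_diag A cenA offA i j) (sqr_diag B cenB offB i j) -![_ * _]/(e _) eij.
have e_opp i j : i != j -> e i = - e j.
  move=> nij; have : e i ^+ 2 == e j ^+ 2.
    by rewrite /e !exprMn (sqr_diag A cenA offA i j) (sqr_diag B cenB offB i j).
  by rewrite eqf_sqr => /orP[/eqP/e_inj eij|/eqP //]; rewrite eij eqxx in nij.
(* Since [1 < n], there are three distinct indices 0, 1, 2; [e] takes the value [- e ord0] at both 1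
   and 2, against injectivity. *)
pose k1 : 'I_n.+1 := inord 1; pose k2 : 'I_n.+1 := inord 2.
have k1E : k1 = 1%N :> nat by rewrite inordK // ltnS ltnW.
have k2E : k2 = 2%N :> nat by rewrite inordK.
have k10 : k1 != ord0 by rewrite -val_eqE /= k1E.
have k20 : k2 != ord0 by rewrite -val_eqE /= k2E.
have /(congr1 val) : k1 = k2.
  by apply: e_inj; rewrite (e_opp k1 ord0) // (e_opp k2 ord0).
by rewrite /= k1E k2E.
Qed.

Lemma exists_trace0_distinct_sqr (F : fieldType) n :
  [pchar F] =i pred0 -> (1 < n)%N ->
  exists2 c : 'rV[F]_n.+1,
    \tr (diag_mx c) = 0 & injective (fun i => c 0 i ^+ 2).
Proof.
move=> charF0 n_gt1; pose S := (\sum_(k < n) k.+1)%N.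
(* For [1 < n] the sum contains the distinct terms 1 and [n]. This keeps the absolute values [m i]
   strictly increasing up to the last one, [S]. *)
have S_gt : (n < S)%N.
  rewrite /S; case: n n_gt1 {S} => [|[|n]] // _.
  by rewrite big_ord_recr big_ord_recl /=; lia.
pose m (i : 'I_n.+1) := if (i < n)%N then i.+1 else S.
have m_mono (i j : 'I_n.+1) : (i < j)%N -> (m i < m j)%N.
  rewrite /m => lt_ij; have := ltn_ord i; have := ltn_ord j.
  by case: (ltnP i n); case: (ltnP j n); lia.
pose c : 'rV[F]_n.+1 :=
  \row_i (if (i < n)%N then (m i)%:R else - (m i)%:R).
exists c.
  rewrite mxtrace_diag big_ord_recr /= !mxE /m /= ltnn natr_sum.
  apply/eqP; rewrite subr_eq0; apply/eqP; apply: eq_bigr => i _.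
  by rewrite !mxE /m /= ltn_ord.
have c2E i : c 0 i ^+ 2 = (m i ^ 2)%:R.
  by rewrite mxE natrX; case: ifP; rewrite ?sqrrN.
have c2_lt (i j : 'I_n.+1) : (i < j)%N -> c 0 i ^+ 2 <> c 0 j ^+ 2.
  move=> /m_mono lt_m /eqP; rewrite eq_sym !c2E -subr_eq0 -natrB ?leq_sqr 1?ltnW //.
  (* Characteristic 0 turns the equality of squares in [F] into one between natural numbers. *)
  by rewrite ((pcharf0P F).1 charF0) subn_eq0 leq_sqr leqNgt lt_m.
move=> i j eq_c; apply: val_inj; case: (ltngtP i j) => // lt_ij.
- by case: (c2_lt i j lt_ij).
- by case: (c2_lt j i lt_ij).
Qed.

Theorem theorem1p2 (F : fieldType) (charF0 : [pchar F] =i pred0)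
    (n : nat) (n_gt2 : (2 < n.+1)%N) (f : ncpoly F)
    (f_2central : is_2central 'M[F]_n.+1 f) :
  ~ (forall M : 'M[F]_n.+1, \tr M = 0 ->
       exists (alpha beta : F) (A B : 'M[F]_n.+1),
         [/\ ncimage 'M[F]_n.+1 f A, ncimage 'M[F]_n.+1 f B
           & M = alpha *: A + beta *: B])
  /\
  ~ (forall M : 'M[F]_n.+1, \tr M = 0 ->
       exists A B : 'M[F]_n.+1,
         [/\ ncimage 'M[F]_n.+1 f A, ncimage 'M[F]_n.+1 f B & M = A - B]).
Proof.
set P := (X in ~ X /\ _); set Q := (X in _ /\ ~ X).
have QP : Q -> P.
  move=> allM M /allM[A [B [fA fB ->]]]; exists 1, (- 1), A, B.
  by rewrite scale1r scaleN1r.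
suff nP : ~ P by split=> // /QP.
have [c trc c2_inj] := exists_trace0_distinct_sqr F n charF0 n_gt2.
move=> /(_ _ trc) [alpha [beta [A [B [fA fB]]]]].
by apply: diag_mx_sqr_neq_add => //; apply: in_center_sqrZ;
  apply: (ncimage_sqr_center F _ f).
Qed.
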